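(* Let $r\ge k\ge 2$ be integers and let $s_1,\ldots,s_r\in\mathbb{C}$. If $\Re s_i>1$ for all $1\le i\le r$, then $$\sum_{n_1,\ldots,n_r=1}^{\infty}\frac{\varrho_{r,k}(n_1,\ldots,n_r)}{n_1^{s_1}\cdots n_r^{s_r}}=\zeta(s_1)\cdots\zeta(s_r)\,D_{r,k}(s_1,\ldots,s_r),$$ where $$D_{r,k}(s_1,\ldots,s_r)=\prod_p\left(1-\sum_{j=k}^r(-1)^{j-k}\binom{j-1}{k-1}e_j(p^{-s_1},\ldots,p^{-s_r})\right),$$ the product being over all primes $p$. Moreover, for $s_1,\ldots,s_r\in\mathbb{C}$, $D_{r,k}(s_1,\ldots,s_r)$ (regarded as a multiple Dirichlet series) is absolutely convergent if and only if $\Re(s_{i_1}+\cdots+s_{i_j})>1$ for every $1\le i_1<\cdots<i_j\le r$ with $k\le j\le r$.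
   Context: Positive integers $n_1,\ldots,n_r$ are called $k$-wise relatively prime if $\gcd(n_{i_1},\ldots,n_{i_k})=1$ for every $1\le i_1<\cdots<i_k\le r$. The function $\varrho_{r,k}$ is the characteristic function of the set of $r$-tuples of positive integers whose components are $k$-wise relatively prime: $\varrho_{r,k}(n_1,\ldots,n_r)=1$ if $n_1,\ldots,n_r$ are $k$-wise relatively prime and $0$ otherwise. $\zeta$ is the Riemann zeta function. $e_j(x_1,\ldots,x_r)=\sum_{1\le i_1<\cdots<i_j\le r}x_{i_1}\cdots x_{i_j}$ is the elementary symmetric polynomial of degree $j$, with $e_0=1$. Absolute convergence of $D_{r,k}(s_1,\ldots,s_r)$ means absolute convergence of the multiple Dirichlet series $\sum_{n_1,\ldots,n_r=1}^\infty \psi_{r,k}(n_1,\ldots,n_r)\,n_1^{-s_1}\cdots n_r^{-s_r}$ obtained by formally multiplying out the product over primes, where each factor is viewed as a polynomial in $p^{-s_1},\ldots,p^{-s_r}$. *)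

(* Defs.v *)
From HB Require Import structures.
From mathcomp Require Import all_boot all_order all_algebra finmap.
From mathcomp Require Import all_classical all_reals all_analysis.
From mathcomp.analysis.showcase Require summability.
From mathcomp.real_closed Require Import complex.
From mathcomp.multinomials Require Import -(notations) mpoly.

Set Implicit Arguments.
Unset Strict Implicit.
Unset Printing Implicit Defensive.

Import Order.TTheory GRing.Theory Num.Theory.
Import numFieldNormedType.Exports.

Local Open Scope classical_set_scope.
Local Open Scope ring_scope.

(* The usual topology of the complex numbers, given by their norm. *)
HB.instance Definition _ (R : realType) := NormedModule.copy R[i] R[i]^o.

Definition cexp (R : realType) (z : R[i]) : R[i] :=
  (expR (complex.Re z))%:C%C * (cos (complex.Im z) +i* sin (complex.Im z))%C.

(* m ^ s = exp (s log m); only meaningful for m > 0. *)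
Definition natcpow (R : realType) (m : nat) (s : R[i]) : R[i] :=
  cexp (s * (ln (m%:R : R))%:C%C).

(* The Riemann zeta function on the half-plane Re s > 1 (elsewhere the series
   diverges and the limit is a default value). *)
Definition zeta (R : realType) (s : R[i]) : R[i] :=
  limn (series (fun m => (natcpow m.+1 s)^-1)).

Definition positive_tuples (r : nat) : set {ffun 'I_r -> nat} :=
  [set n | forall i, (0 < n i)%N].

(* Sum of a family of complex numbers over D along the directed set of finite
   subsets; such unconditional convergence is equivalent to absolute
   convergence. *)
Definition has_sum (R : realType) (T : choiceType) (D : set T)
    (f : T -> R[i]) (l : R[i]) : Prop :=
  (fun A : {fset T} => \sum_(t <- A | t \in D) f t)
    @ summability.totally --> l.

Definition abs_convergent (R : realType) (T : choiceType) (D : set T)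
    (f : T -> R[i]) : Prop :=
  (\esum_(t in D) (complex.Re `|f t|)%:E < +oo)%E.

(* The gcd runs over the k-element sets {i_1 < ... < i_k} of indices. *)
Definition kwise_coprime (r k : nat) (n : {ffun 'I_r -> nat}) : bool :=
  [forall I : {set 'I_r},
     (#|I| == k) ==> (\big[gcdn/0%N]_(i in I) n i == 1%N)].

Definition rho (r k : nat) (n : {ffun 'I_r -> nat}) : nat :=
  kwise_coprime k n.

Definition esymf (A : comNzRingType) (r j : nat) (x : 'I_r -> A) : A :=
  \sum_(I : {set 'I_r} | #|I| == j) \prod_(i in I) x i.

(* The factor of D_{r,k} at a prime, at x_i = p ^ (- s_i). It is defined over any
   commutative ring so that it can be taken both at complex numbers and at the
   indeterminates of a polynomial ring. *)
Definition local_factor (A : comNzRingType) (r k : nat) (x : 'I_r -> A) : A :=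
  1 - \sum_(k <= j < r.+1)
        (-1) ^+ (j - k) * ('C(j.-1, k.-1))%:R * esymf j x.

Definition D_partial (R : realType) (r k : nat) (s : 'I_r -> R[i]) (N : nat)
    : R[i] :=
  \prod_(0 <= p < N | prime p) local_factor k (fun i => natcpow p (- s i)).

Definition D_prod (R : realType) (r k : nat) (s : 'I_r -> R[i]) : R[i] :=
  limn (D_partial k s).

Definition local_poly (r k : nat) : mpoly.mpoly r int :=
  local_factor k (fun i => mpoly.mpolyX int (mpoly.mnm1 i)).

(* The term of the expanded product in n_1 ^ (- s_1) ... n_r ^ (- s_r) picks, at
   each prime p, the monomial whose i-th exponent is the p-adic valuation of
   n_i. Primes dividing no n_i contribute the constant coefficient, 1. *)
Definition psi (r k : nat) (n : {ffun 'I_r -> nat}) : int :=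
  \prod_(p <- primes (\prod_(i < r) n i)%N)
    mpoly.mcoeff (mpoly.Multinom [tuple logn p (n i) | i < r])
      (local_poly r k).

Definition D_term (R : realType) (r k : nat) (s : 'I_r -> R[i])
    (n : {ffun 'I_r -> nat}) : R[i] :=
  (psi k n)%:~R * \prod_(i < r) natcpow (n i) (- s i).

(* Main.v *)
Require Import Defs.
From mathcomp Require Import all_boot all_order all_algebra.
From mathcomp Require Import all_classical all_reals all_analysis.
From mathcomp Require Import finmap zify ring lra.
From mathcomp.real_closed Require Import complex.
From mathcomp.multinomials Require Import -(notations) mpoly.

Set Implicit Arguments.
Unset Strict Implicit.
Unset Printing Implicit Defensive.

Import Order.TTheory GRing.Theory Num.Theory.
Import numFieldNormedType.Exports.

Local Open Scope classical_set_scope.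
Local Open Scope ring_scope.

(* At [x_i = 1] if [p] divides [n_i] and [x_i = 0] otherwise, the local factor
   is 1 or 0 according as fewer than [k] of the [n_i] are divisible by [p].
   Since it is multilinear, discarding from the sum of n_1^-s_1 ... n_r^-s_r the
   tuples with at least [k] components divisible by [p] multiplies that sum by
   the local factor at [x_i = p^-s_i]. Sieving successively by the primes below
   [N] therefore turns the product of the zeta values into its product with the
   [N]-th partial Euler product, and dominated convergence gives the formula.
   For [k = 1] only the tuple (1, ..., 1) survives, so the product of the zeta
   values is nonzero and the Euler product itself converges.

   The absolute values of the expanded series are dominated by the product over
   primes of sums of |c_I| p^-sigma_I, where c_I is the coefficient of the
   squarefree monomial indexed by [I] and sigma_I the sum of the real parts of
   the s_i, [i] in [I]. Conversely the tuples equal to [p] on [I] and to 1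
   elsewhere contribute at least the sum of p^-sigma_I, which diverges for
   sigma_I <= 1 like the sum of the reciprocals of the primes. *)

(** * The local factor *)

(** The coefficient of each squarefree monomial of degree [j] in the local factor. The factor
    [k <= j] replaces the lower summation bound, since [j - k] truncates below [k]. *)
Definition sieve_coef (k j : nat) : int :=
  (j == 0)%N%:R - (k <= j)%:R * ((-1) ^+ (j - k) * ('C(j.-1, k.-1))%:R).

Lemma local_factorE (A : comNzRingType) (r k : nat) (x : 'I_r -> A) :
  local_factor k x =
  \sum_(I : {set 'I_r}) (sieve_coef k #|I|)%:~R * \prod_(i in I) x i.
Proof.
rewrite /local_factor; under [RHS]eq_bigr => I _.
  rewrite /sieve_coef rmorphB /= mulrBl.
  over.
rewrite big_split /= sumrN; congr (_ - _).
  rewrite (bigD1 finset.set0) //= cards0 eqxx big_set0 mulr1 big1 ?addr0 // => I I0.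
  by rewrite cards_eq0 (negPf I0) mul0r.
rewrite /esymf; under eq_bigr do rewrite mulr_sumr.
rewrite (exchange_big_dep xpredT) //=; apply: eq_bigr => I _.
have Ir : (#|I| <= r)%N by rewrite -[X in (_ <= X)%N](card_ord r) max_card.
under eq_bigl do rewrite eq_sym.
rewrite big_nat1_eq ltnS Ir andbT; case: leqP => kI; last by rewrite mul0r mul0r.
by rewrite mul1r rmorphM rmorphXn rmorphN1 rmorph_nat.
Qed.

Lemma mul_bin_bin (m n p : nat) : (p <= n)%N -> (n <= m)%N ->
  ('C(m, n) * 'C(n, p) = 'C(m, p) * 'C(m - p, n - p))%N.
Proof.
move=> pn nm; have pm := leq_trans pn nm.
have h1 := bin_fact nm; have h2 := bin_fact pn; have h3 := bin_fact pm.
have h4 := bin_fact (leq_sub2r p nm).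
have e : (m - p - (n - p) = m - n)%N by lia.
rewrite e in h4.
have z : (0 < p`! * (n - p)`! * (m - n)`!)%N by rewrite !muln_gt0 !fact_gt0.
apply/eqP; rewrite -(eqn_pmul2r z); apply/eqP.
transitivity (m`!); first by rewrite -h1 -h2; ring.
by rewrite -h3 -h4; ring.
Qed.

Lemma sum_signed_bin (n M : nat) : (n < M)%N ->
  \sum_(t < M) (-1) ^+ t * ('C(n, t))%:R = (n == 0)%N%:R :> int.
Proof.
move=> nM; transitivity ((1 - 1 : int) ^+ n); last by rewrite subrr expr0n.
rewrite exprBn.
rewrite (big_ord_widen M (fun t => (-1) ^+ t * 1 ^+ (n - t) * 1 ^+ t *+ 'C(n, t))) //.
rewrite [RHS]big_mkcond; apply: eq_bigr => t _.
rewrite !expr1n !mulr1; case: ifP => h; first by rewrite mulr_natr.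
by rewrite bin_small ?mulr0 // ltnNge -ltnS h.
Qed.

(** Induction on [m] with Pascal's rule: the increment from [m] to [m.+1] becomes, by [mul_bin_bin],
    a multiple of an alternating binomial sum, which vanishes unless the threshold is crossed at
    that very step. *)
Lemma sieve_sum (k m r : nat) : (0 < k)%N -> (m <= r)%N ->
  \sum_(k <= j < r.+1) (-1) ^+ (j - k) * ('C(j.-1, k.-1) * 'C(m, j))%:R
   = (k <= m)%:R :> int.
Proof.
case: k => // k _; elim: m => [|m IH] mr.
  rewrite big_nat_cond big1 // => -[//|j] _; first by rewrite bin0n /= muln0 mulr0.
have : \sum_(k.+1 <= j < r.+1) (-1) ^+ (j - k.+1) * ('C(j.-1, k) * 'C(m, j.-1))%:R
    = (m == k)%:R :> int.
  rewrite -[X in \sum_(X <= _ < _) _]add0n big_addn big_mkord.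
  case: (ltnP m k) => mk.
    rewrite ltn_eqF // big1 // => j _; rewrite addnS /=.
    by rewrite [X in (_ * X)%N]bin_small ?muln0 ?mulr0 //; lia.
  transitivity (\sum_(t < r.+1 - k.+1) ('C(m, k))%:R *
      ((-1) ^+ t * ('C(m - k, t))%:R) : int).
    apply: eq_bigr => t _; rewrite addnK addnS /= mulrCA -natrM; congr (_ * _%:R).
    case: (leqP (t + k) m) => h.
      by rewrite mulnC mul_bin_bin ?leq_addl // addnK.
    by rewrite (bin_small h) muln0 (@bin_small (m - k) t) ?muln0 //; lia.
  rewrite -mulr_sumr sum_signed_bin; last lia.
  have -> : (m - k == 0)%N = (m == k) by lia.
  by case: eqP => [->|]; rewrite ?binn ?mulr1 ?mulr0.
move=> e; rewrite (_ : (k < m.+1)%:R = (k < m)%:R + (m == k)%:R :> int); last first.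
  by rewrite -natrD; congr _%:R; lia.
rewrite -e -IH ?(ltnW mr) // -big_split /=; apply: eq_big_nat => -[//|j] _ /=.
by rewrite -mulrDr -natrD -mulnDr binS.
Qed.

(** At a 0/1 point [esymf j] counts the [j]-subsets of the support of [b], so it equals
    ['C(#|b|, j)] and [sieve_sum] applies. *)
Lemma local_factor_indicator (A : comNzRingType) (r k : nat) (b : pred 'I_r) :
  (0 < k)%N ->
  local_factor k (fun i => (b i)%:R : A) = (#|b| < k)%:R.
Proof.
move=> k0; rewrite /local_factor.
have es j : esymf j (fun i => (b i)%:R) = ('C(#|b|, j))%:R :> A.
  rewrite /esymf.
  transitivity (\sum_(I : {set 'I_r} | #|I| == j) ((I \subset [set i | b i]%SET)%:R : A)).
    apply: eq_bigr => I _; have [h|/fintype.subsetPn[i iI]] := boolP (_ \subset _).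
      by rewrite big1 // => i /(fintype.subsetP h); rewrite inE => ->.
    by rewrite inE => bi; rewrite (bigD1 i) //= (negPf bi) mul0r.
  rewrite -natr_sum -big_mkcondr sum1_card; congr _%:R.
  rewrite -[in RHS]cardsE -cards_draws; apply: eq_card => I.
  by rewrite !inE andbC.
under eq_bigr do rewrite es -mulrA -natrM.
have h := @sieve_sum k #|b| r k0; rewrite -[X in (_ <= X)%N]card_ord max_card in h.
have /(congr1 (fun z : int => z%:~R : A)) := h isT.
rewrite rmorph_sum /= rmorph_nat => e.
rewrite (eq_bigr (fun j =>
    ((-1) ^+ (j - k) * ('C(j.-1, k.-1) * 'C(#|b|, j))%:R : int)%:~R)) => [|j _].
  by rewrite e ltnNge; case: (k <= _)%N; rewrite ?subrr ?subr0.
by rewrite [RHS]rmorphM rmorphXn rmorphN1 rmorph_nat.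
Qed.

(** * Absolute values and powers of complex numbers *)

Section ComplexPowers.
Variable R : realType.
Implicit Types (s t z w : R[i]) (m n : nat).

(** The norm on [R[i]] takes values in [R[i]]; the real part makes it comparable with real
    bounds. *)
Definition cabs z : R := complex.Re `|z|.

Lemma normcabs z : `|z| = (cabs z)%:C%C.
Proof. by rewrite /cabs normc_def. Qed.

Lemma cabsM z w : cabs (z * w) = cabs z * cabs w.
Proof. by apply: complexI; rewrite -normcabs normrM !normcabs rmorphM. Qed.

Lemma cabsD z w : cabs (z + w) <= cabs z + cabs w.
Proof. by rewrite -lecR rmorphD /= -!normcabs ler_normD. Qed.

Lemma cabsN z : cabs (- z) = cabs z.
Proof. by rewrite /cabs normrN. Qed.

Lemma cabs_sub z w : cabs (z - w) = cabs (w - z).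
Proof. by rewrite -cabsN opprB. Qed.

Lemma cabs_dist w z1 z2 : cabs (z1 - z2) <= cabs (z1 - w) + cabs (w - z2).
Proof. by rewrite -[X in cabs X](subrKA w) cabsD. Qed.

Lemma cabs0 : cabs 0 = 0.
Proof. by rewrite /cabs normr0. Qed.

Lemma cabs1 : cabs 1 = 1.
Proof. by rewrite /cabs normr1. Qed.

Lemma cabs_ge0 z : 0 <= cabs z.
Proof. by rewrite -ler0c -normcabs normr_ge0. Qed.

Lemma cabs_sum (I : Type) (r : seq I) (P : pred I) (F : I -> R[i]) :
  cabs (\sum_(i <- r | P i) F i) <= \sum_(i <- r | P i) cabs (F i).
Proof.
elim/big_rec2: _ => [|i y z _ h]; first by rewrite cabs0.
by apply: le_trans (cabsD _ _) _; rewrite lerD2l.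
Qed.

Lemma cabs_prod (I : Type) (r : seq I) (P : pred I) (F : I -> R[i]) :
  cabs (\prod_(i <- r | P i) F i) = \prod_(i <- r | P i) cabs (F i).
Proof. exact: (big_morph _ cabsM cabs1). Qed.

Lemma cabs_int (a : int) : cabs a%:~R = `|a|%:~R.
Proof.
apply: complexI; rewrite -normcabs -intr_norm.
by rewrite [RHS]rmorph_int.
Qed.

Lemma cabs_real (x : R) : 0 <= x -> cabs x%:C%C = x.
Proof. by move=> x0; apply: complexI; rewrite -normcabs ger0_norm // ler0c. Qed.

Lemma cabs_Re z : `|complex.Re z| <= cabs z.
Proof. by rewrite -lecR -normcabs normc_ge_Re. Qed.

Lemma cabs_Im z : `|complex.Im z| <= cabs z.
Proof.
have := cabs_Re (z * 'i%C); rewrite ReiNIm normrN cabsM.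
by rewrite [cabs 'i%C]/cabs normc_def /= expr0n expr1n add0r sqrtr1 mulr1.
Qed.

Lemma cabs_ReIm z : cabs z <= `|complex.Re z| + `|complex.Im z|.
Proof.
rewrite [z in X in X <= _]complexE; apply: le_trans (cabsD _ _) _.
rewrite cabsM [cabs 'i%C]/cabs normc_def /= expr0n expr1n add0r sqrtr1 mul1r.
have h (x : R) : cabs x%:C%C = `|x|.
  by rewrite /cabs normc_def /= expr0n addr0 sqrtr_sqr.
by rewrite !h.
Qed.

Lemma cexpD z w : cexp (z + w) = cexp z * cexp w.
Proof.
case: z w => [a b] [c d]; rewrite /cexp /= expRD cosD sinD.
by apply/eqP; rewrite eq_complex /=; apply/andP; split; apply/eqP; ring.
Qed.

Lemma cexp0 : cexp (0 : R[i]) = 1.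
Proof.
rewrite /cexp /= expR0 cos0 sin0.
by apply/eqP; rewrite eq_complex /= !mul0r mul1r subr0 mulr0 addr0 !eqxx.
Qed.

Lemma cexpN z : cexp (- z) = (cexp z)^-1.
Proof.
have e : cexp (- z) * cexp z = 1 by rewrite -cexpD addNr cexp0.
by rewrite -(mulr1_eq e) invrK.
Qed.

Lemma cabs_cexp z : cabs (cexp z) = expR (complex.Re z).
Proof.
rewrite /cexp cabsM cabs_real ?expR_ge0 //.
by rewrite /cabs normc_def /= cos2Dsin2 sqrtr1 mulr1.
Qed.

Lemma natcpowM m n s : (0 < m)%N -> (0 < n)%N ->
  natcpow (m * n) s = natcpow m s * natcpow n s.
Proof.
move=> m0 n0; rewrite /natcpow natrM lnM ?posrE ?ltr0n //.
by rewrite rmorphD mulrDr cexpD.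
Qed.

Lemma natcpowN m s : natcpow m (- s) = (natcpow m s)^-1.
Proof. by rewrite /natcpow mulNr cexpN. Qed.

Lemma natcpow1 s : natcpow 1 s = 1.
Proof. by rewrite /natcpow ln1 rmorph0 mulr0 cexp0. Qed.

Lemma cabs_natcpow m s : (0 < m)%N -> cabs (natcpow m s) = m%:R `^ complex.Re s.
Proof.
move=> m0; rewrite /natcpow cabs_cexp /powR pnatr_eq0 -[(m == 0)%N]negbK -lt0n m0 /=.
by case: s => a b; rewrite /= mulr0 subr0.
Qed.

End ComplexPowers.

(** * Unconditional sums *)

Section Sums.
Variable R : realType.
Implicit Types (e : R) (l : R[i]).

Lemma cvg_cabsP (u : nat -> R[i]) l :
  u @ \oo --> l <->
  (forall e, 0 < e -> exists N, forall n, (N <= n)%N -> cabs (u n - l) <= e).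
Proof.
split=> [/cvgrPdist_le h e e0|h].
  have /h [N _ H] : 0 < e%:C%C by rewrite ltcR.
  by exists N => n /H /=; rewrite normcabs lecR cabs_sub.
apply/cvgrPdist_le => e e0.
have er : (complex.Re e)%:C%C = e by rewrite RRe_real // gtr0_real.
have [|N H] := h (complex.Re e); first by rewrite -ltcR er.
by exists N => // n /= /H; rewrite -er normcabs lecR cabs_sub.
Qed.

(** Completeness is inherited from [R]: real and imaginary parts are Cauchy because each is bounded
    by the modulus. *)
Lemma cauchy_cabs_cvg (u : nat -> R[i]) :
  (forall e, 0 < e -> exists N, forall n, (N <= n)%N -> cabs (u n - u N) <= e) ->
  exists l, u @ \oo --> l.
Proof.
move=> h.
have cvg_part (f : R[i] -> R) : {morph f : x y / x - y} ->
    (forall z, `|f z| <= cabs z) ->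
    exists l : R, (f \o u) @ \oo --> l.
  move=> fB fle; apply/cvg_ex/cauchy_cvgP/cauchy_exP => e e0.
  have [|N H] := h (e / 2); first by rewrite divr_gt0.
  exists (f (u N)); exists N => // n /= /H Hn.
  rewrite /ball /= -fB; apply: le_lt_trans (fle _) _; rewrite cabs_sub.
  by apply: le_lt_trans Hn _; rewrite ltr_pdivrMr // ltr_pMr // ltr1n.
have [a ha] := cvg_part _
  (fun x y => raddfB (@complex.Re R : Rcomplex R -> R) x y) (@cabs_Re R).
have [b hb] := cvg_part _
  (fun x y => raddfB (@complex.Im R : Rcomplex R -> R) x y) (@cabs_Im R).
exists (a +i* b)%C; apply/cvg_cabsP => e e0.
have e2 : 0 < e / 2 by rewrite divr_gt0.
move/cvgrPdist_le : ha => /(_ _ e2) [N _ HN].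
move/cvgrPdist_le : hb => /(_ _ e2) [M _ HM].
exists (maxn N M) => n; rewrite geq_max => /andP[/HN hn /HM hm].
apply: le_trans (cabs_ReIm _) _; move: hn hm; rewrite /=.
case: (u n) => x y /=; rewrite distrC (distrC b) => hx hy.
by rewrite [leRHS](splitr e) lerD.
Qed.

Variable T : choiceType.
Implicit Types (D : set T) (f g : T -> R[i]) (A B : {fset T}).

Lemma has_sumP D f l :
  has_sum D f l <->
  (forall e, 0 < e -> exists A, forall B, (A `<=` B)%fset ->
     cabs (\sum_(t <- B | t \in D) f t - l) <= e).
Proof.
have FF : Filter (@summability.totally T) by apply: summability.totally_filter.
split=> [/cvgrPdist_le h e e0|h].
  have /h [A _ H] : 0 < e%:C%C by rewrite ltcR.
  by exists A => B /H /=; rewrite normcabs lecR cabs_sub.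
apply/cvgrPdist_le => e e0.
have er : (complex.Re e)%:C%C = e by rewrite RRe_real // gtr0_real.
have [|A H] := h (complex.Re e); first by rewrite -ltcR er.
by exists A => // B /= /H; rewrite -er normcabs lecR cabs_sub.
Qed.

Lemma eq_has_sum D f g l : (forall t, D t -> f t = g t) ->
  has_sum D f l -> has_sum D g l.
Proof.
move=> fg; rewrite /has_sum; suff -> : (fun A : {fset T} => \sum_(t <- A | t \in D) f t) =
  (fun A => \sum_(t <- A | t \in D) g t) by [].
by apply/funext => A; apply: eq_bigr => t /set_mem /fg.
Qed.

Lemma has_sumD D f g l m : has_sum D f l -> has_sum D g m ->
  has_sum D (fun t => f t + g t) (l + m).
Proof.
move=> hf hg; rewrite /has_sum.
under eq_fun do rewrite big_split /=.
by have FF := @summability.totally_filter T; exact: cvgD.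
Qed.

Lemma has_sumZ D f l c : has_sum D f l -> has_sum D (fun t => c * f t) (c * l).
Proof.
move=> hf; rewrite /has_sum.
under eq_fun do rewrite -mulr_sumr.
by have FF := @summability.totally_filter T; exact: cvgMr.
Qed.

Lemma has_sum0 D : has_sum D (fun=> 0 : R[i]) 0.
Proof.
rewrite /has_sum; under eq_fun do rewrite big1 //.
by have FF := @summability.totally_filter T; exact: cvg_cst.
Qed.

Lemma has_sum_sum D (I : Type) (r : seq I) (F : I -> T -> R[i]) (L : I -> R[i]) :
  (forall i, has_sum D (F i) (L i)) ->
  has_sum D (fun t => \sum_(i <- r) F i t) (\sum_(i <- r) L i).
Proof.
move=> h; elim: r => [|i r IH].
  rewrite big_nil; apply: eq_has_sum (has_sum0 D) => t _; by rewrite big_nil.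
rewrite big_cons; apply: eq_has_sum (has_sumD (h i) IH) => t _.
by rewrite big_cons.
Qed.

Lemma has_sum_single D f t0 : D t0 -> (forall t, D t -> t != t0 -> f t = 0) ->
  has_sum D f (f t0).
Proof.
move=> D0 h; apply/has_sumP => e e0; exists [fset t0]%fset => B.
rewrite fsub1set => tB; rewrite big_mkcond (big_fsetD1 t0) //= mem_set //.
rewrite big1_seq ?addr0 ?subrr ?cabs0 ?ltW // => t.
by rewrite in_fsetD1 /= => /andP[tt0 _]; case: ifP => // /set_mem tD; rewrite h.
Qed.

(** The third hypothesis makes [f] vanish on [D] outside the image of [h], so only the part of a
    finite set inside that image counts, and it can be pulled back along [h]. *)
Lemma has_sum_reindex D (h h' : T -> T) f l :
  cancel h h' -> (forall t, D (h t) <-> D t) ->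
  (forall t, D t -> h (h' t) != t -> f t = 0) ->
  has_sum D (f \o h) l -> has_sum D f l.
Proof.
move=> hK hD f0 /has_sumP H; apply/has_sumP => e /H [A HA].
exists (h @` A)%fset => B AB.
(* This is the preimage of [B] under [h]; cutting it out of the image under [h'] keeps it visibly
   finite. *)
pose B' := [fset t in [fset h' t | t in B] | h t \in B]%fset.
have AB' : (A `<=` B')%fset.
  apply/fsubsetP => t tA; rewrite !inE /=.
  have htB : h t \in B by apply: (fsubsetP AB); rewrite in_imfset.
  by rewrite htB andbT -[t]hK in_imfset.
move: (HA _ AB'); congr (cabs (_ - _) <= _).
have -> : \sum_(t <- B' | t \in D) (f \o h) t = \sum_(t <- (h @` B')%fset | t \in D) f t.
  rewrite big_mkcond [RHS]big_mkcond [RHS]big_imfset /=.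
    by apply: eq_bigr => t _; rewrite (_ : (t \in D) = (h t \in D)) //;
       apply/idP/idP => /set_mem /hD /mem_set.
  by move=> x y _ _; exact: (can_inj hK).
rewrite big_mkcond [RHS]big_mkcond; apply: big_fset_incl.
  by apply/fsubsetP => t /imfsetP[x /=]; rewrite !inE /= => /andP[_ ?] ->.
move=> t tB tB'; case: ifP => // /set_mem tD; apply: f0 => //.
apply: contra tB' => /eqP ht; apply/imfsetP; exists (h' t) => //=.
by rewrite !inE /= ht tB andbT in_imfset.
Qed.

End Sums.

Arguments eq_has_sum {R T D f g l} _ _.
Arguments has_sumD {R T D f g l m} _ _.
Arguments has_sumZ {R T D f l} c _.
Arguments has_sum_sum {R T D I r F L} _.
Arguments has_sum_reindex {R T D h h' f l} _ _ _ _.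

Lemma sum_fset_widen (T : choiceType) (V : nmodType) (A B : {fset T})
    (F : T -> V) : (A `<=` B)%fset ->
  \sum_(t <- A) F t = \sum_(t <- B) (if t \in A then F t else 0).
Proof.
move=> AB; rewrite -(big_fset_incl _ AB) => [|t _ /negPf ->] //.
by rewrite big_seq [RHS]big_seq; apply: eq_bigr => t ->.
Qed.

(** * Dominated convergence for sums exhausted by finite boxes; [K] is the total mass of the weight
    [W] *)

Section Dominated.
Variables (R : realType) (T : choiceType) (D : set T).
Variables (W : T -> R) (box : nat -> {fset T}) (K : R).
Hypothesis box_mono : forall M N, (M <= N)%N -> (box M `<=` box N)%fset.
Hypothesis box_sub : forall M t, t \in box M -> D t.
Hypothesis box_exhaust : forall A : {fset T},
  exists M, forall t, t \in A -> D t -> t \in box M.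
Hypothesis W_le : forall M, \sum_(t <- box M) W t <= K.
Hypothesis W_ge : forall e, 0 < e -> exists M, K - e <= \sum_(t <- box M) W t.

Let W_dominates (g : T -> R[i]) := forall t, D t -> cabs (g t) <= W t.

(** The part of [B] in [D] fits into a larger box [N], so the difference is bounded by the weight of
    box [N] minus that of box [M], and the former is at most [K]. *)
Lemma box_tail (g : T -> R[i]) M (B : {fset T}) : W_dominates g ->
  (box M `<=` B)%fset ->
  cabs (\sum_(t <- B | t \in D) g t - \sum_(t <- box M) g t) <=
  K - \sum_(t <- box M) W t.
Proof.
move=> gW MB; have [N' hN'] := box_exhaust B.
pose N := maxn M N'; have MN : (box M `<=` box N)%fset by rewrite box_mono ?leq_maxl.
have hN t : t \in B -> D t -> t \in box N.
  by move=> tB tD; apply: (fsubsetP (box_mono (leq_maxr M N'))); apply: hN'.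
have -> : \sum_(t <- B | t \in D) g t = \sum_(t <- box N) if t \in B then g t else 0.
  rewrite big_fset_condE /= (@sum_fset_widen _ _ _ (box N)).
    rewrite big_seq [RHS]big_seq; apply: eq_bigr => t /box_sub tD.
    by rewrite !inE /= mem_set ?andbT.
  by apply/fsubsetP => t; rewrite !inE /= => /andP[tB /set_mem]; apply: hN.
rewrite (sum_fset_widen g MN) -sumrB.
apply: le_trans (cabs_sum _ _ _) _.
apply: le_trans (_ : _ <= \sum_(t <- box N) W t - \sum_(t <- box M) W t) _; last first.
  by rewrite lerD2r.
rewrite (sum_fset_widen W MN) -sumrB big_seq [leRHS]big_seq; apply: ler_sum => t tN.
have W0 : 0 <= W t by apply: le_trans (gW t (box_sub tN)); apply: cabs_ge0.
case: (boolP (t \in box M)) => tM.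
  by rewrite (fsubsetP MB _ tM) !subrr cabs0.
by rewrite !subr0; case: ifP => _; rewrite ?cabs0 // gW //; apply: box_sub tN.
Qed.

Lemma has_sum_box (g : T -> R[i]) l : W_dominates g ->
  (fun M => \sum_(t <- box M) g t) @ \oo --> l -> has_sum D g l.
Proof.
move=> gW /cvg_cabsP gl; apply/has_sumP => e e0.
have e2 : 0 < e / 2 by rewrite divr_gt0.
have [N HN] := gl _ e2; have [M HM] := W_ge e2.
exists (box (maxn M N)) => B hB.
apply: le_trans (cabs_dist (\sum_(t <- box (maxn M N)) g t) _ _) _.
rewrite [leRHS](splitr e) lerD ?HN ?leq_maxr //.
apply: le_trans (box_tail gW hB) _; rewrite lerBlDl -lerBlDr.
apply: le_trans HM _; rewrite (sum_fset_widen W (box_mono (leq_maxl M N))) !big_seq.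
apply: ler_sum => t /box_sub tD; case: ifP => // _.
by apply: le_trans (gW t tD); apply: cabs_ge0.
Qed.

(** The bound of [box_tail] is uniform in the finite set, hence passes to the limit. *)
Lemma has_sum_box_dist (g : T -> R[i]) l M : W_dominates g -> has_sum D g l ->
  cabs (l - \sum_(t <- box M) g t) <= K - \sum_(t <- box M) W t.
Proof.
move=> gW /has_sumP gl; apply/ler_addgt0Pr => e /gl[A HA].
have h2 := HA (A `|` box M)%fset (fsubsetUl _ _).
have h1 := box_tail gW (fsubsetUr A (box M)).
apply: le_trans (cabs_dist (\sum_(t <- (A `|` box M)%fset | t \in D) g t) _ _) _.
by rewrite addrC lerD // cabs_sub.
Qed.

(** For large [N] the function [F N] agrees with [f] on box [M], so [L N] lies within the tail
    weight [d M] of the box sum [b M]. Hence [L] is Cauchy and the box sums share its limit. *)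
Lemma has_sum_dominated (F : nat -> T -> R[i]) (f : T -> R[i]) (L : nat -> R[i]) :
  (forall N, W_dominates (F N)) -> W_dominates f ->
  (forall N, has_sum D (F N) (L N)) ->
  (forall M, exists N0, forall N t, (N0 <= N)%N -> t \in box M -> F N t = f t) ->
  exists2 l, L @ \oo --> l & has_sum D f l.
Proof.
move=> FW fW FL Ff.
pose b M := \sum_(t <- box M) f t.
pose d M := K - \sum_(t <- box M) W t.
have Lb M : exists N0, forall N, (N0 <= N)%N -> cabs (L N - b M) <= d M.
  have [N0 HN0] := Ff M; exists N0 => N /HN0 h.
  have := has_sum_box_dist M (FW N) (FL N).
  by rewrite [X in _ - X]big_seq (eq_bigr f) -?big_seq // => t; apply: h.
have [|l Ll] := @cauchy_cabs_cvg R L.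
  move=> e e0; have [M HM] := W_ge (divr_gt0 e0 (ltr0n _ 2)).
  have [N0 HN0] := Lb M; exists N0 => N hN.
  apply: le_trans (cabs_dist (b M) _ _) _; rewrite [leRHS](splitr e).
  have dM : d M <= e / 2 by rewrite /d lerBlDl -lerBlDr.
  by rewrite lerD ?(le_trans (HN0 _ _) dM) // cabs_sub (le_trans (HN0 _ _) dM).
exists l => //; apply: has_sum_box => //; apply/cvg_cabsP => e e0.
have [M HM] := W_ge (divr_gt0 e0 (ltr0n _ 2)).
exists M => M' MM'; have [N0 HN0] := Lb M'.
have /cvg_cabsP/(_ _ (divr_gt0 e0 (ltr0n _ 2))) [N1 HN1] := Ll.
apply: le_trans (cabs_dist (L (maxn N0 N1)) _ _) _; rewrite [leRHS](splitr e).
rewrite lerD ?HN1 ?leq_maxr // cabs_sub.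
apply: le_trans (HN0 _ (leq_maxl _ _)) _; rewrite /d lerBlDl -lerBlDr.
apply: le_trans HM _; rewrite (sum_fset_widen W (box_mono MM')) !big_seq.
apply: ler_sum => t /box_sub tD; case: ifP => // _.
by apply: le_trans (fW t tD); apply: cabs_ge0.
Qed.

End Dominated.

(** * Zeta values as sums over boxes *)

Section Zeta.
Variable R : realType.

(* With [a = x - 1 > 0], [a m^-x <= (m - 1)^-a - m^-a] and the bounds telescope. *)
Lemma zeta_partial_le (x : R) M : 1 < x ->
  \sum_(0 <= m < M) (m.+1)%:R `^ (- x) <= 1 + (x - 1)^-1.
Proof.
move=> x1; pose a := x - 1; have a0 : 0 < a by rewrite subr_gt0.
suff h : \sum_(0 <= m < M.+1) (m.+1)%:R `^ (- x) <=
    1 + a^-1 * (1 - (M.+1)%:R `^ (- a)).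
  apply: le_trans (_ : _ <= 1 + a^-1 * (1 - (M.+1)%:R `^ (- a))) _.
    apply: le_trans h; rewrite big_nat_recr //= lerDl powR_ge0 //.
  by rewrite lerD2l ler_piMr ?invr_ge0 ?ltW // gerBl powR_ge0.
elim: M => [|M IH]; first by rewrite big_nat1 !powR1 subrr mulr0 addr0.
rewrite big_nat_recr //=; apply: le_trans (lerD IH (lexx _)) _.
rewrite -addrA lerD2l -lerBrDl -mulrBr ler_pdivlMl //.
rewrite [leRHS](_ : _ = M.+1%:R `^ (- a) - M.+2%:R `^ (- a)); last by ring.
set m : R := M.+2%:R; have m0 : 0 < m by rewrite ltr0n.
have mE : M.+1%:R = m * (1 - m^-1) :> R.
  by rewrite mulrBr mulr1 divff ?gt_eqF // /m -[in RHS]natr1 addrK.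
have q0 : 0 < 1 - m^-1 by rewrite -(pmulr_rgt0 _ m0) -mE ltr0n.
have -> : m `^ (- x) = m `^ (- a) * m^-1.
  rewrite -powR_inv1 ?ltW // -powRD; last by rewrite (gt_eqF m0) implybT.
  by congr (_ `^ _); rewrite /a; ring.
rewrite mE (powRM _ (ltW m0) (ltW q0)).
rewrite (_ : _ - _ = m `^ (- a) * ((1 - m^-1) `^ (- a) - 1)); last by ring.
rewrite mulrCA ler_pM2l ?powR_gt0 // lerBrDl /powR gt_eqF //.
(* The remaining bound [1 + a/m <= (1 - 1/m)^-a] follows from [exp t >= 1 + t] and
   [ln (1 - 1/m) <= -1/m]. *)
apply: le_trans (expR_ge1Dx _); rewrite lerD2l mulNr -mulrN ler_pM2l // lerNr.
by apply: le_ln1Dx; rewrite -subr_gt0 opprK addrC.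
Qed.

Definition real_zeta (x : R) : R := limn (series (fun m => (m.+1)%:R `^ (- x))).

Lemma cvg_real_zeta (x : R) : 1 < x ->
  series (fun m => (m.+1)%:R `^ (- x)) @ \oo --> real_zeta x.
Proof.
move=> x1; apply: nondecreasing_is_cvgn.
  by apply/nondecreasing_series => n _ _; apply: powR_ge0.
by exists (1 + (x - 1)^-1) => _ [M _ <-]; apply: zeta_partial_le.
Qed.

Lemma real_zeta_ge (x : R) M : 1 < x ->
  series (fun m => (m.+1)%:R `^ (- x)) M <= real_zeta x.
Proof.
move=> x1; apply: nondecreasing_cvgn_le; last exact: cvg_real_zeta.
by apply/nondecreasing_series => n _ _; apply: powR_ge0.
Qed.

Lemma cabs_natcpowV m (s : R[i]) : (0 < m)%N ->
  cabs (natcpow m s)^-1 = m%:R `^ (- complex.Re s).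
Proof. by move=> m0; rewrite -natcpowN cabs_natcpow //; case: s. Qed.

(** Blocks of the complex series are dominated in modulus by the same blocks of the real one, so the
    partial sums are Cauchy. *)
Lemma cvg_zeta (s : R[i]) : 1 < complex.Re s ->
  series (fun m => (natcpow m.+1 s)^-1) @ \oo --> zeta s.
Proof.
move=> s1; suff [l hl] : exists l : R[i],
    series (fun m => (natcpow m.+1 s)^-1) @ \oo --> l.
  by rewrite /zeta (cvg_lim (@norm_hausdorff _ _) hl).
apply: cauchy_cabs_cvg => e e0.
have /cvgrPdist_le/(_ _ e0) [N _ HN] := cvg_real_zeta s1.
exists N => n Nn; apply: le_trans (HN N (leqnn _)).
rewrite ger0_norm ?subr_ge0 ?real_zeta_ge //.
apply: le_trans (lerB (real_zeta_ge n s1) (lexx _)).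
rewrite !sub_series_geq //; apply: le_trans (cabs_sum _ _ _) _.
by apply: ler_sum => m _; rewrite cabs_natcpowV.
Qed.

Variable r : nat.

(** The shift makes components run from 1 to [M]. Presenting a box as an image of finite functions
    lets a product of sums be distributed over it. *)
Definition succ_tuple M (g : {ffun 'I_r -> 'I_M}) : {ffun 'I_r -> nat} :=
  [ffun i => (g i).+1].

Definition box M : {fset {ffun 'I_r -> nat}} :=
  [fset succ_tuple g | g : {ffun 'I_r -> 'I_M} in predT]%fset.

Lemma in_boxP M (n : {ffun 'I_r -> nat}) :
  reflect (forall i, 0 < n i <= M)%N (n \in box M).
Proof.
apply: (iffP (imfsetP _ _ _ _)) => [[g _ ->] i|h]; first by rewrite ffunE ltn_ord.
have hM i : ((n i).-1 < M)%N by case/andP: (h i); case: (n i).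
exists [ffun i => Ordinal (hM i)] => //.
by apply/ffunP => i; rewrite !ffunE /= prednK //; case/andP: (h i).
Qed.

Lemma prod_box (A : comNzRingType) M (F : 'I_r -> nat -> A) :
  \sum_(n <- box M) \prod_i F i (n i) = \prod_i \sum_(0 <= m < M) F i m.+1.
Proof.
rewrite /box big_imfset /=; last first.
  move=> g g' _ _ /ffunP e; apply/ffunP => i; apply: val_inj.
  by have := e i; rewrite !ffunE => -[].
rewrite big_enum /=; under [RHS]eq_bigr do rewrite big_mkord.
rewrite bigA_distr_bigA; apply: eq_bigr => g _; apply: eq_bigr => i _.
by rewrite ffunE.
Qed.

Lemma box_mono M N : (M <= N)%N -> (box M `<=` box N)%fset.
Proof.
move=> MN; apply/fsubsetP => n /in_boxP h; apply/in_boxP => i.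
by have /andP[-> /leq_trans->] := h i.
Qed.

Lemma box_positive M (n : {ffun 'I_r -> nat}) : n \in box M -> @positive_tuples r n.
Proof. by move=> /in_boxP h i; case/andP: (h i). Qed.

Lemma box_exhaust (A : {fset {ffun 'I_r -> nat}}) :
  exists M, forall n, n \in A -> @positive_tuples r n -> n \in box M.
Proof.
exists (\max_(n <- A) \max_i n i)%N => n nA n0; apply/in_boxP => i.
rewrite n0 (leq_trans (leq_bigmax i)) //.
by rewrite (big_fsetD1 n) //= leq_maxl.
Qed.

Section Weights.
Variable s : 'I_r -> R[i].
Hypothesis s1 : forall i, 1 < complex.Re (s i).

Definition tuple_weight (n : {ffun 'I_r -> nat}) : R :=
  \prod_i (n i)%:R `^ (- complex.Re (s i)).

Definition weight_sum : R := \prod_i real_zeta (complex.Re (s i)).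

Lemma weight_le M : \sum_(n <- box M) tuple_weight n <= weight_sum.
Proof.
rewrite /tuple_weight (prod_box M (fun i m => m%:R `^ (- complex.Re (s i)))).
apply: ler_prod => i _; rewrite sumr_ge0 /=; last by move=> *; apply: powR_ge0.
exact: (real_zeta_ge M (s1 i)).
Qed.

Lemma weight_ge e : 0 < e ->
  exists M, weight_sum - e <= \sum_(n <- box M) tuple_weight n.
Proof.
have h : (fun M => \sum_(n <- box M) tuple_weight n) @ \oo --> weight_sum.
  rewrite /tuple_weight; under eq_fun do
    rewrite (prod_box _ (fun i m => m%:R `^ (- complex.Re (s i)))).
  apply: cvg_big => [|i _]; first exact: mul_continuous.
  exact: (cvg_real_zeta (s1 i)).
move=> e0; move/cvgrPdist_le : h => /(_ _ e0) [M _ HM].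
exists M; have := HM M (leqnn M).
rewrite ler_norml => /andP[_]; rewrite lerBlDl => h; by rewrite lerBlDr.
Qed.

Lemma cabs_prod_natcpowV (n : {ffun 'I_r -> nat}) : @positive_tuples r n ->
  cabs (\prod_i natcpow (n i) (s i))^-1 = tuple_weight n.
Proof.
move=> n0; rewrite -prodfV cabs_prod; apply: eq_bigr => i _.
by rewrite cabs_natcpowV.
Qed.

(** Over a box the sum is exactly the product of the zeta partial sums, so box sums converge;
    domination by [tuple_weight] makes the convergence unconditional. *)
Lemma has_sum_prod_zeta :
  has_sum (@positive_tuples r) (fun n => (\prod_i natcpow (n i) (s i))^-1)
    (\prod_i zeta (s i)).
Proof.
apply: (has_sum_box box_mono box_positive box_exhaust weight_le weight_ge).
  by move=> n n0; rewrite cabs_prod_natcpowV.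
rewrite [X in X @ _](_ : _ = fun M =>
    \prod_i series (fun m => (natcpow m.+1 (s i))^-1) M); last first.
  apply/funext => M; rewrite -(prod_box M (fun i m => (natcpow m (s i))^-1)).
  by apply: eq_bigr => n _; rewrite -prodfV.
apply: cvg_big => [|i _]; first exact: mul_continuous.
exact: (cvg_zeta (s1 i)).
Qed.

End Weights.
End Zeta.

(** * The sieve *)

Section Sieve.
Variables (R : realType) (r k : nat).
Hypothesis k_gt0 : (0 < k)%N.
Local Notation tuples := {ffun 'I_r -> nat}.

(** Only primes strictly below [N] are tested, as in the range of [D_partial]. *)
Definition sieved (N : nat) (n : tuples) : bool :=
  [forall p : 'I_N, prime p ==> (#|[pred i | p %| n i]%N| < k)%N].

Lemma sievedP N (n : tuples) : reflect
  (forall p, (p < N)%N -> prime p -> (#|[pred i | p %| n i]%N| < k)%N) (sieved N n).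
Proof.
apply: (iffP forallP) => [h p pN pp|h p]; last by apply/implyP; apply: h.
exact: implyP (h (Ordinal pN)) pp.
Qed.

Lemma sieved0 (n : tuples) : sieved 0 n.
Proof. by apply/sievedP. Qed.

Lemma sievedS N (n : tuples) :
  sieved N.+1 n = sieved N n && (prime N ==> (#|[pred i | N %| n i]%N| < k)%N).
Proof.
apply/sievedP/andP => [h|[/sievedP h /implyP h'] p].
  split; first by apply/sievedP => p pN; apply: h; rewrite ltnS ltnW.
  by apply/implyP; apply: h.
by rewrite ltnS leq_eqVlt => /predU1P[->|]; [exact: h'|exact: h].
Qed.

(** A prime dividing [k] components divides the gcd over some [k]-set; conversely a gcd other than 1
    has a prime divisor, which divides all [k] components. *)
Lemma gcd_kwise_coprime (n : tuples) : positive_tuples n ->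
  kwise_coprime k n <->
  (forall p, prime p -> (#|[pred i | p %| n i]%N| < k)%N).
Proof.
move=> n0; split=> [/forallP h p pp|h].
  rewrite ltnNge; apply/negP => kp.
  have [I [IB kI]] : exists I : {set 'I_r},
      I \subset [set i | p %| n i]%SET%N /\ #|I| = k.
    have : (0 < #|[set I : {set 'I_r} | I \subset [set i | p %| n i]%SET & #|I| == k]|)%N.
      by rewrite cards_draws bin_gt0 cardsE.
    by case/card_gt0P => I; rewrite inE => /andP[? /eqP ?]; exists I.
  have /implyP/(_ _)/eqP gI := h I; rewrite kI eqxx in gI.
  have : (p %| \big[gcdn/0]_(i in I) n i)%N.
    apply/dvdn_biggcdP => i iI.
    by have := fintype.subsetP IB i iI; rewrite inE.
  by rewrite gI // dvdn1 => /eqP p1; move: pp; rewrite p1.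
apply/forallP => I; apply/implyP => /eqP kI.
set g := \big[_/_]_(_ in _) _.
have [i0 iI] : exists i, i \in I by apply/card_gt0P; rewrite kI.
(* A gcd equal to 0 would force a zero component, so a gcd other than 1 exceeds 1 and has a prime
   divisor. *)
have g0 : (0 < g)%N.
  rewrite lt0n; apply/negP => /eqP gE.
  have /dvdn_biggcdP/(_ i0 iI) : (g %| g)%N by [].
  by rewrite gE dvd0n => /eqP ni; have := n0 i0; rewrite ni.
rewrite eqn_leq g0 andbT leqNgt; apply/negP => /pdivP[p pp pg].
have := h p pp; rewrite ltnNge -kI => /negP; apply.
apply: subset_leq_card; apply/fintype.subsetP => i iI'.
by rewrite inE; move/dvdn_biggcdP : pg; apply.
Qed.

(** A prime [p >= N] exceeds every component and divides none of them. *)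
Lemma sieved_rho M N (n : tuples) : n \in @box r M -> (M < N)%N ->
  sieved N n = kwise_coprime k n.
Proof.
move=> nM MN; have n0 := box_positive nM; move/in_boxP: nM => nM.
apply/idP/idP => [/sievedP h|/(gcd_kwise_coprime n0) h]; last first.
  by apply/sievedP => p _; apply: h.
apply/(gcd_kwise_coprime n0) => p.
move=> pp; have [/h->//|Np] := ltnP p N.
rewrite eq_card0 // => i; rewrite !inE; apply/negP => /(dvdn_leq (n0 i)) pn.
by have /andP[_] := nM i; rewrite leqNgt (leq_trans MN) // (leq_trans Np).
Qed.

Definition mul_at (p : nat) (I : {set 'I_r}) (n : tuples) : tuples :=
  [ffun i => if i \in I then (p * n i)%N else n i].

Definition div_at (p : nat) (I : {set 'I_r}) (n : tuples) : tuples :=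
  [ffun i => if i \in I then (n i %/ p)%N else n i].

Lemma mul_atK p I : (0 < p)%N -> cancel (mul_at p I) (div_at p I).
Proof.
move=> p0 n; apply/ffunP => i; rewrite !ffunE; case: (i \in I) => //.
by rewrite mulKn.
Qed.

Lemma sieved_mul_at p I n : prime p -> sieved p (mul_at p I n) = sieved p n.
Proof.
move=> pp; apply: eq_forallb => q; case: (boolP (prime q)) => //= qq.
congr (_ < _)%N; apply: eq_card => i; rewrite !inE ffunE; case: ifP => // _.
rewrite Gauss_dvdr // prime_coprime // dvdn_prime2 //.
by rewrite ltn_eqF.
Qed.

Variable s : 'I_r -> R[i].
Hypothesis s1 : forall i, 1 < complex.Re (s i).

(** The divisibility indicators select the image of [mul_at p I]. Pulling back along it extracts the
    powers of [p] and preserves the sieve condition, which concerns only primes below [p]. *)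
Lemma has_sum_multiples p (I : {set 'I_r}) (l : R[i]) : prime p ->
  has_sum (@positive_tuples r)
    (fun n => (sieved p n)%:R / \prod_i natcpow (n i) (s i)) l ->
  has_sum (@positive_tuples r)
    (fun n => (sieved p n)%:R / \prod_i natcpow (n i) (s i) *
              \prod_(i in I) (p %| n i)%N%:R)
    ((\prod_(i in I) natcpow p (- s i)) * l).
Proof.
move=> pp hl; have p0 := prime_gt0 pp.
apply: (has_sum_reindex (mul_atK I p0)).
- move=> n; split=> h i; have := h i; rewrite ffunE; case: ifP => // _.
    by rewrite muln_gt0 => /andP[].
  by move=> ni; rewrite muln_gt0 p0.
- move=> n _ hn; have [i iI pn] : exists2 i, i \in I & ~~ (p %| n i)%N.
    apply/exists_inP; apply: contraR hn => /exists_inPn h.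
    apply/eqP/ffunP => i; rewrite !ffunE; case: (boolP (i \in I)) => // iI.
    by rewrite mulnC divnK //; have := h i iI; rewrite negbK.
  by rewrite [X in _ * X](bigD1 i) //= (negPf pn) mul0r mulr0.
apply: eq_has_sum (has_sumZ _ hl) => n n0 /=.
rewrite sieved_mul_at // [X in _ = _ * X]big1 ?mulr1; last first.
  by move=> i iI; rewrite ffunE iI dvdn_mulr.
rewrite mulrCA; congr (_ * _).
under eq_bigr do rewrite natcpowN.
rewrite prodfV -invfM; congr (_^-1).
rewrite big_mkcond -big_split /=; apply: eq_bigr => i _.
by rewrite ffunE; case: ifP => _; rewrite ?mul1r // natcpowM ?n0.
Qed.

(** At a prime [N] the local factor is expanded over subsets, each term being a sum over multiples.
    Recombined inside the sum, the indicators form the local factor at a 0/1 point, which is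
    precisely the new sieve condition. *)
Lemma has_sum_sieved N :
  has_sum (@positive_tuples r)
    (fun n => (sieved N n)%:R / \prod_i natcpow (n i) (s i))
    ((\prod_i zeta (s i)) * D_partial k s N).
Proof.
elim: N => [|N IH].
  rewrite /D_partial big_geq // mulr1; apply: eq_has_sum (has_sum_prod_zeta s1).
  by move=> n n0; rewrite sieved0 mul1r.
have -> : D_partial k s N.+1 = D_partial k s N *
    (if prime N then local_factor k (fun i => natcpow N (- s i)) else 1).
  by rewrite /D_partial big_mkcond big_nat_recr //= -big_mkcond.
case: ifP => pN; last first.
  by rewrite mulr1; apply: eq_has_sum IH => n _; rewrite sievedS pN andbT.
rewrite mulrA local_factorE mulr_sumr.
have h (I : {set 'I_r}) := has_sumZ (sieve_coef k #|I|)%:~R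
  (@has_sum_multiples N I _ pN IH).
rewrite (eq_bigr (fun I : {set 'I_r} => (sieve_coef k #|I|)%:~R *
    ((\prod_(i in I) natcpow N (- s i)) *
     ((\prod_i zeta (s i)) * D_partial k s N)))) => [|I _]; last first.
  by rewrite [LHS]mulrC -mulrA.
apply: eq_has_sum (has_sum_sum h) => n n0.
rewrite sievedS pN /=.
rewrite (eq_bigr _ (fun I _ => mulrCA _ _ _)).
rewrite -mulr_sumr -local_factorE local_factor_indicator //.
by rewrite mulrAC -natrM mulnb.
Qed.

Lemma has_sum_sieve_limit : exists2 l : R[i],
  (fun N => (\prod_i zeta (s i)) * D_partial k s N) @ \oo --> l &
  has_sum (@positive_tuples r)
    (fun n => (rho k n)%:R / \prod_i natcpow (n i) (s i)) l.
Proof.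
have dom (b : tuples -> bool) (n : tuples) : @positive_tuples r n ->
    cabs ((b n)%:R / \prod_i natcpow (n i) (s i)) <= tuple_weight s n.
  move=> n0; rewrite cabsM cabs_prod_natcpowV //.
  case: (b n); rewrite ?cabs0 ?cabs1 ?mul0r ?mul1r //.
  by rewrite /tuple_weight prodr_ge0 // => i _; apply: powR_ge0.
apply: (has_sum_dominated (@box_mono r) (@box_positive r) (@box_exhaust r)
  (weight_le s1) (weight_ge s1)) (has_sum_sieved) _.
- by move=> N; apply: dom.
- exact: dom.
- by move=> M; exists M.+1 => N n MN nM; rewrite (sieved_rho nM).
Qed.

End Sieve.

(** * Nonvanishing of the zeta product and the Euler product formula *)

Section FirstPart.
Variables (R : realType) (r : nat) (s : 'I_r -> R[i]).
Hypothesis s1 : forall i, 1 < complex.Re (s i).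

Lemma prod_zeta_neq0 : \prod_i zeta (s i) != 0.
Proof.
(* Sieving with [k = 1] leaves only the all-ones tuple, so the limit is 1, whereas a vanishing zeta
   product would make it 0. *)
have [l Ll hl] := has_sum_sieve_limit (ltn0Sn 0) s1.
pose n1 : {ffun 'I_r -> nat} := [ffun=> 1%N].
have n1P : positive_tuples n1 by move=> i; rewrite ffunE.
pose f (n : {ffun 'I_r -> nat}) : R[i] := (rho 1 n)%:R / \prod_i natcpow (n i) (s i).
have f1 : f n1 = 1.
  rewrite /f [X in _ / X]big1 => [|i _]; last by rewrite ffunE natcpow1.
  rewrite divr1 /rho (_ : kwise_coprime 1 n1) //; apply/gcd_kwise_coprime => //.
  move=> p pp; rewrite ltnS leqn0; apply/eqP/eq_card0 => i.
  by rewrite !inE ffunE dvdn1; case: eqP => // p1; rewrite p1 in pp.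
have h1 : has_sum (@positive_tuples r) f (f n1).
  apply: has_sum_single => //.
  move=> n n0 nn1; rewrite /f /rho.
  case: (boolP (kwise_coprime 1 n)) => [|_]; last by rewrite mul0r.
  move/(gcd_kwise_coprime (ltn0Sn 0) n0) => h; case/negP: nn1; apply/eqP/ffunP => i.
  rewrite ffunE; apply/eqP; rewrite eqn_leq n0 andbT leqNgt.
  apply/negP => /pdivP[p pp pi].
  have := h p pp; rewrite ltnS leqn0 => /eqP/card0_eq/(_ i).
  by rewrite inE pi.
have FF := @summability.totally_filter {ffun 'I_r -> nat}.
have l1 : l = 1 by rewrite -f1; move: hl h1; apply: cvg_unique; exact: norm_hausdorff.
apply/negP => /eqP Z0; have : l = 0.
  move: Ll; rewrite Z0; under eq_fun do rewrite mul0r.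
  by move/(cvg_lim (@norm_hausdorff _ _)); rewrite lim_cst //; exact: norm_hausdorff.
by move/eqP; rewrite l1 oner_eq0.
Qed.

(** The sieve controls only the zeta product times [D_partial]; dividing by the nonzero zeta product
    yields convergence of the Euler product, so that [D_prod] is a genuine limit. *)
Lemma kwise_coprime_series k : (0 < k)%N ->
  cvgn (D_partial k s) /\
  has_sum (@positive_tuples r)
    (fun n => (rho k n)%:R / \prod_(i < r) natcpow (n i) (s i))
    ((\prod_(i < r) zeta (s i)) * D_prod k s).
Proof.
move=> k0; have [l Ll hl] := has_sum_sieve_limit k0 s1.
have Z0 := prod_zeta_neq0.
have DE : D_partial k s @ \oo --> l / \prod_i zeta (s i).
  have -> : D_partial k s = fun N => (\prod_i zeta (s i))^-1 *
      (\prod_i zeta (s i) * D_partial k s N) by apply/funext => N; rewrite mulKf.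
  by rewrite mulrC; exact: cvgMr.
split; first by apply/cvg_ex; eexists; exact: DE.
have e : l = (\prod_i zeta (s i)) * D_prod k s.
  have -> : D_prod k s = l / \prod_i zeta (s i).
    by apply: cvg_lim DE; apply: norm_hausdorff.
  by rewrite [RHS]mulrC divfK.
exact: (eq_ind _ (has_sum _ _) hl _ e).
Qed.

End FirstPart.

(** * The expanded series *)

Section Psi.
Variables (r k : nat).
Hypothesis k_gt0 : (0 < k)%N.
Local Notation tuples := {ffun 'I_r -> nat}.

Definition local_coef (v : 'I_r -> nat) : int :=
  mcoeff (Multinom [tuple v i | i < r]) (local_poly r k).

(** The local polynomial is multilinear: the exponent vector of the monomial indexed by [I] is the
    indicator of [I]. *)
Lemma local_coefE (v : 'I_r -> nat) :
  local_coef v =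
  \sum_(I : {set 'I_r}) sieve_coef k #|I| * [forall i, v i == (i \in I)]%:R.
Proof.
rewrite /local_coef /local_poly local_factorE raddf_sum /=; apply: eq_bigr => I _.
rewrite mulrzl raddfMz /= -mulrzr mulrC intz; congr (_ * _).
rewrite mprodXE mcoeffX; congr (_ : bool)%:R.
have E i : (\big[mnm_add/mnm0]_(j in I) mnm1 j) i = (i \in I).
  rewrite mnm_sumE; under eq_bigr do rewrite mnm1E.
  case: (boolP (i \in I)) => iI; last first.
    by rewrite big1 // => j jI; case: eqP jI => // ->; rewrite (negPf iI).
  by rewrite (bigD1 i) //= eqxx big1 // => j /andP[_ /negPf ->].
apply/eqP/forallP => [e i|e]; last first.
  by apply/mnmP => i; rewrite E mnmE (eqP (e i)).
by have := E i; rewrite e mnmE => ->.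
Qed.

Lemma local_coef_indicator (I : {set 'I_r}) :
  local_coef (fun i => i \in I) = sieve_coef k #|I|.
Proof.
rewrite local_coefE (bigD1 I) //= (introT forallP _) // mulr1 big1 ?addr0 // => J JI.
case: forallP => [h|_]; last by rewrite mulr0.
case/eqP: JI; apply/setP => i.
by have := h i; case: (i \in I); case: (i \in J).
Qed.

Lemma local_coef0 (v : 'I_r -> nat) : (forall i, v i = 0%N) -> local_coef v = 1.
Proof.
move=> v0; have := local_coef_indicator finset.set0.
rewrite cards0 /sieve_coef leqNgt k_gt0 mul0r subr0 => e.
transitivity (local_coef (fun i => i \in (finset.set0 : {set 'I_r}))); last by rewrite e.
rewrite /local_coef; congr (mcoeff _ _); apply/mnmP => i.
by rewrite !mnmE v0 inE.
Qed.

(** Primes dividing no component contribute 1, so the product can run over a range common to the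
    whole box, ready for comparison with a truncated Euler product. *)
Lemma psiE M (n : tuples) : n \in box r M ->
  psi k n = \prod_(0 <= p < M.+1 | prime p) local_coef (fun i => logn p (n i)).
Proof.
move=> nM; have n0 := box_positive nM; move/in_boxP: nM => nM.
have P0 : (0 < \prod_(i < r) n i)%N by rewrite prodn_gt0.
rewrite /psi -/(local_coef _).
transitivity (\prod_(p <- [seq p <- index_iota 0 M.+1 | p \in primes (\prod_(i < r) n i)])
    local_coef (fun i => logn p (n i))).
  apply: perm_big; apply: uniq_perm; rewrite ?primes_uniq ?filter_uniq ?iota_uniq //.
  move=> p; rewrite mem_filter mem_index_iota /=.
  case: (boolP (p \in primes _)) => //; rewrite mem_primes => /and3P[pp _].
  rewrite Euclid_dvd_prod // big_orE => /existsP[i /(dvdn_leq (n0 i)) pn].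
  by have /andP[_ niM] := nM i; rewrite ltnS (leq_trans pn niM).
rewrite big_filter big_mkcond [RHS]big_mkcond; apply: eq_bigr => p _.
rewrite mem_primes; case: (boolP (prime p)) => //= pp; rewrite P0 /=.
case: ifP => // /negbT pP; rewrite local_coef0 // => i.
apply/eqP; rewrite -leqn0 leqNgt logn_gt0 mem_primes pp n0 /=.
by apply: contra pP => pi; rewrite (bigD1 i) //= dvdn_mulr.
Qed.
End Psi.

Lemma prod_prime_powers M n : (0 < n <= M)%N ->
  n = (\prod_(0 <= p < M.+1 | prime p) p ^ logn p n)%N.
Proof.
case/andP => n0 nM; rewrite -[LHS](partnT n0) (widen_partn _ nM) /=.
rewrite [LHS]big_mkcond [RHS]big_mkcond; apply: eq_bigr => p _.
by case: (boolP (prime p)) => //= /negPf pp; rewrite lognE pp.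
Qed.

Lemma powR_prod (R : realType) (I : Type) (r : seq I) (P : pred I) (F : I -> R) a :
  (forall i, 0 <= F i) ->
  (\prod_(i <- r | P i) F i) `^ a = \prod_(i <- r | P i) F i `^ a.
Proof.
move=> F0; elim: r => [|i r IH]; first by rewrite !big_nil powR1.
by rewrite !big_cons; case: ifP => // _; rewrite powRM ?IH ?prodr_ge0.
Qed.

Lemma sum_injective_le1 (R : numDomainType) (T : choiceType) (A : {fset T}) (Q : pred T) :
  (forall x y, x \in A -> y \in A -> Q x -> Q y -> x = y) ->
  \sum_(x <- A) (Q x)%:R <= 1 :> R.
Proof.
move=> inj; case: (boolP (has Q A)) => [/hasP[x xA Qx]|/hasPn h].
  rewrite (big_fsetD1 x) //= Qx big1_seq ?addr0 // => y /= /fsetD1P[yx yA].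
  case: (boolP (Q y)) => // Qy; case/eqP: yx; exact: inj.
by rewrite big1_seq // => x /= /h /negPf ->.
Qed.

(** * Sufficiency of the condition for absolute convergence *)

Section AbsoluteBound.
Variables (R : realType) (r k : nat) (s : 'I_r -> R[i]).
Hypothesis k_gt0 : (0 < k)%N.
Local Notation tuples := {ffun 'I_r -> nat}.

Definition local_weight (p : nat) (I : {set 'I_r}) : R :=
  `|sieve_coef k #|I| |%:~R * \prod_(i in I) p%:R `^ (- complex.Re (s i)).

Lemma local_weight_ge0 p I : 0 <= local_weight p I.
Proof.
rewrite mulr_ge0 ?ler0z ?normr_ge0 //.
by rewrite prodr_ge0 // => i _; apply: powR_ge0.
Qed.

Lemma cabs_D_term M (n : tuples) : n \in box r M ->
  cabs (D_term k s n) = \prod_(0 <= p < M.+1 | prime p)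
   (`|local_coef k (fun i => logn p (n i))|%:~R *
    \prod_i (p%:R `^ (- complex.Re (s i))) ^+ logn p (n i)).
Proof.
move=> nM; have n0 := box_positive nM.
rewrite /D_term cabsM cabs_int (psiE k_gt0 nM) normr_prod rmorph_prod [RHS]big_split /=.
congr (_ * _); rewrite cabs_prod exchange_big /=; apply: eq_bigr => i _.
rewrite cabs_natcpow //; have -> : complex.Re (- s i) = - complex.Re (s i) by case: (s i).
move/in_boxP: nM => /(_ i) /prod_prime_powers {1}->.
rewrite natr_prod powR_prod => [|p]; last exact: ler0n.
by apply: eq_bigr => p _; rewrite natrX -!powR_mulrn ?powR_ge0 ?ler0n // powRAC.
Qed.

Lemma local_term_le p (v : 'I_r -> nat) :
  `|local_coef k v|%:~R * \prod_i (p%:R `^ (- complex.Re (s i))) ^+ v i <=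
  \sum_I local_weight p I * [forall i, v i == (i \in I)]%:R.
Proof.
rewrite local_coefE.
apply: le_trans (_ : _ <= (\sum_(I : {set 'I_r})
   `|sieve_coef k #|I| |%:~R * [forall i, v i == (i \in I)]%:R) *
    \prod_i (p%:R `^ (- complex.Re (s i))) ^+ v i) _.
  apply: ler_wpM2r; first by rewrite prodr_ge0 // => i _; rewrite exprn_ge0 ?powR_ge0.
  rewrite intr_norm rmorph_sum /=; apply: le_trans (ler_norm_sum _ _ _) _.
  apply: ler_sum => I _; rewrite rmorphM /= normrM intr_norm; apply: ler_wpM2l => //.
  by rewrite rmorph_nat normr_nat.
rewrite mulr_suml; apply: ler_sum => I _.
case: forallP => [h|_]; last by rewrite mulr0 mul0r mulr0.
rewrite !mulr1 /local_weight [X in _ <= _ * X]big_mkcond /=.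
rewrite (eq_bigr (fun i => if i \in I then p%:R `^ (- complex.Re (s i)) else 1)) //.
by move=> i _; rewrite (eqP (h i)); case: (i \in I).
Qed.

(** Expanding the product over primes yields one term for each choice [f] of a subset at every
    prime. By unique factorization each choice arises from at most one tuple in the box. *)
Lemma sum_D_term_le M :
  \sum_(n <- box r M) cabs (D_term k s n) <=
  \prod_(0 <= p < M.+1 | prime p) \sum_I local_weight p I.
Proof.
rewrite big_mkord (big_distr_big finset.set0) /=.
(* [Q f n]: at each prime [p] the valuations of [n] form the indicator of [f p]. *)
pose Q (f : {ffun 'I_M.+1 -> {set 'I_r}}) (n : tuples) :=
  [forall p : 'I_M.+1, prime p ==> [forall i, logn p (n i) == (i \in f p)]].
apply: le_trans (_ : _ <= \sum_(n <- box r M)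
   \sum_(f in pffun_on finset.set0 [pred p : 'I_M.+1 | prime p] predT)
     (\prod_(p < M.+1 | prime p) local_weight p (f p)) * (Q f n)%:R) _.
  rewrite big_seq [leRHS]big_seq; apply: ler_sum => n nM.
  rewrite (cabs_D_term nM) big_mkord.
  apply: le_trans (_ : _ <= \prod_(p < M.+1 | prime p) \sum_I
    local_weight p I * [forall i, logn p (n i) == (i \in I)]%:R) _.
    apply: ler_prod => p _; rewrite local_term_le andbT.
    by rewrite mulr_ge0 ?ler0z // prodr_ge0 // => i _; rewrite exprn_ge0 ?powR_ge0.
  rewrite (big_distr_big finset.set0) /=; apply: ler_sum => f _.
  rewrite big_split /= ler_wpM2l //.
    by rewrite prodr_ge0 // => p _; apply: local_weight_ge0.
  rewrite /Q; case: forallP => [_|h].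
    by apply: prodr_ile1 => p _; case: [forall _, _]; rewrite ?ler01 ?lexx.
  have [p pp hp] : exists2 p : 'I_M.+1, prime p &
      ~~ [forall i, logn p (n i) == (i \in f p)].
    apply/exists_inP; apply: contra_notT h => /exists_inPn h p.
    by apply/implyP => /h; rewrite negbK.
  by rewrite (bigD1 p) //= (negPf hp) mul0r.
rewrite exchange_big /=; apply: ler_sum => f _; rewrite -mulr_sumr.
rewrite ler_piMr //; first by rewrite prodr_ge0 // => p _; apply: local_weight_ge0.
apply: sum_injective_le1 => n m /in_boxP nM /in_boxP mM /forallP Qn /forallP Qm.
apply/ffunP => i; rewrite (prod_prime_powers (nM i)) (prod_prime_powers (mM i)).
rewrite !big_mkord; apply: eq_bigr => p pp; congr (_ ^ _)%N.
have /implyP/(_ pp)/forallP/(_ i)/eqP -> := Qn p.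
by have /implyP/(_ pp)/forallP/(_ i)/eqP -> := Qm p.
Qed.

Hypothesis sI : forall I : {set 'I_r}, (k <= #|I|)%N ->
  1 < complex.Re (\sum_(i in I) s i).

Lemma prod_powR (p : nat) (I : {set 'I_r}) : (0 < p)%N ->
  \prod_(i in I) p%:R `^ (- complex.Re (s i)) =
  p%:R `^ (- complex.Re (\sum_(i in I) s i)) :> R.
Proof.
move=> p0; rewrite (raddf_sum (@complex.Re R : Rcomplex R -> R)) -sumrN.
elim/big_rec2: _ => [|i x y _ ->]; first by rewrite powRr0.
by rewrite powRD // pnatr_eq0 -lt0n p0 implybT.
Qed.

(** The empty set contributes 1 and nonempty sets of fewer than [k] indices contribute 0. Then
    [1 + x <= exp x] turns the product into the exponential of sums over primes, each bounded by a
    real zeta value. *)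
Lemma sum_local_weight_le M :
  \prod_(0 <= p < M.+1 | prime p) \sum_I local_weight p I <=
  expR (\sum_(I : {set 'I_r} | (k <= #|I|)%N)
     `|sieve_coef k #|I| |%:~R * real_zeta (complex.Re (\sum_(i in I) s i))).
Proof.
apply: le_trans (_ : _ <= \prod_(0 <= p < M.+1 | prime p)
    expR (\sum_(I : {set 'I_r} | (k <= #|I|)%N) local_weight p I)) _.
  apply: ler_prod => p _; rewrite sumr_ge0 /=; last first.
    by move=> I _; apply: local_weight_ge0.
  apply: le_trans (expR_ge1Dx _).
  rewrite (bigD1 finset.set0) //=.
  have -> : local_weight p finset.set0 = 1.
    by rewrite /local_weight cards0 /sieve_coef leqNgt k_gt0 mul0r subr0 big_set0 mulr1.
  rewrite lerD2l big_mkcond [leRHS]big_mkcond; apply: ler_sum => I _.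
  case: ifP => I0; case: leqP => kI //; rewrite ?local_weight_ge0 //.
  rewrite /local_weight /sieve_coef cards_eq0 (negPf I0) leqNgt kI mul0r subrr.
  by rewrite normr0 mul0r.
rewrite -expR_sum ler_expR exchange_big /=; apply: ler_sum => I kI.
rewrite /local_weight -mulr_sumr ler_wpM2l ?ler0z //.
apply: le_trans (real_zeta_ge M (sI kI)).
(* The index 0 is not prime; dropping it aligns the sum with the zeta series, whose terms start at
   1. *)
rewrite seriesEnat /= [leLHS]big_mkcond big_nat_recl //= add0r.
apply: ler_sum => p _ /=; case: ifP => pp; last exact: powR_ge0.
by rewrite prod_powR.
Qed.

Lemma D_term_abs_convergent : abs_convergent (@positive_tuples r) (D_term k s).
Proof.
set C := expR (\sum_(I : {set 'I_r} | (k <= #|I|)%N)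
     `|sieve_coef k #|I| |%:~R * real_zeta (complex.Re (\sum_(i in I) s i))).
rewrite /abs_convergent; apply: le_lt_trans (ltry C).
apply: ge_ereal_sup => _ [X [finX XD] <-].
rewrite fsbig_finite // sumEFin lee_fin.
have [M hM] := box_exhaust (fset_set X).
apply: le_trans (sum_local_weight_le M); apply: le_trans (sum_D_term_le M).
have sub : (fset_set X `<=` box r M)%fset.
  apply/fsubsetP => n nX; apply: hM => //; apply: XD.
  by move: nX; rewrite in_fset_set // => /set_mem.
rewrite (sum_fset_widen _ sub); apply: ler_sum => n _.
by case: ifP => // _; apply: cabs_ge0.
Qed.

End AbsoluteBound.

(** * Divergence of the sum of the reciprocals of the primes *)

Section PrimeReciprocals.
Variable R : realType.

Definition rough (Q n : nat) : bool := (n == 1)%N || (Q <= pdiv n)%N.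

Definition rough_sum (M Q : nat) : R :=
  \sum_(n < M.+1 | (0 < n)%N && rough Q n) (n%:R)^-1.

(** An integer with least prime factor [Q] is [Q * m], where the cofactor [m] has no prime factor
    below [Q]. *)
Lemma sum_pdiv_le M Q : prime Q ->
  \sum_(n < M.+1 | (1 < n)%N && (pdiv n == Q)) (n%:R)^-1 <=
  Q%:R^-1 * rough_sum M Q.
Proof.
move=> pQ; have Q0 := prime_gt0 pQ.
apply: le_trans (_ : _ <= \sum_(n < M.+1 | (1 < n)%N && (pdiv n == Q))
    \sum_(m < M.+1 | n == (Q * m)%N :> nat) ((n : nat)%:R)^-1) _.
  apply: ler_sum => n /andP[_ /eqP nQ].
  have Qn : (Q %| n)%N by rewrite -nQ pdiv_dvd.
  have mM : (n %/ Q < M.+1)%N by rewrite (leq_ltn_trans (leq_div _ _)).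
  rewrite (bigD1 (Ordinal mM)) /=; last by rewrite mulnC divnK.
  by rewrite lerDl sumr_ge0 // => m _; rewrite invr_ge0.
rewrite (exchange_big_dep xpredT) //= mulr_sumr [leRHS]big_mkcond /=.
apply: ler_sum => m _.
rewrite (big_ord1_cond_eq _ (fun n => (n%:R)^-1) (fun n => (1 < n)%N && (pdiv n == Q))).
case: ifP => [/and3P[_ Qm1 /eqP Qmp]|_].
  have m0 : (0 < m)%N by case: (m : nat) Qm1 => //; rewrite muln0.
  rewrite m0 /rough (_ : _ || _ = true) ?natrM ?invfM //.
  case: eqP => //= /eqP m1; rewrite -{1}Qmp pdiv_min_dvd ?prime_gt1 ?pdiv_prime //.
  - by rewrite ltn_neqAle eq_sym m1.
  - by rewrite dvdn_mull ?pdiv_dvd.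
by case: ifP => _ //; rewrite mulr_ge0 ?invr_ge0.
Qed.

(** Passing to [Q.+1] discards the integers with least prime factor [Q]: none if [Q] is not prime,
    and otherwise a share bounded by [sum_pdiv_le]. *)
Lemma rough_sumS M Q :
  (if prime Q then 1 - Q%:R^-1 else 1) * rough_sum M Q <= rough_sum M Q.+1.
Proof.
have roughS n : (0 < n)%N -> rough Q.+1 n = rough Q n && ~~ ((1 < n)%N && (pdiv n == Q)).
  move=> n0; rewrite /rough; case: eqP => [->|/eqP n1] //=.
  have -> : (1 < n)%N by rewrite ltn_neqAle eq_sym n1.
  by rewrite ltn_neqAle eq_sym andbC.
have E : rough_sum M Q =
    \sum_(n < M.+1 | [&& (0 < n)%N, rough Q n & (1 < n)%N && (pdiv n == Q)])
      (n%:R)^-1 + rough_sum M Q.+1.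
  rewrite /rough_sum (bigID (fun n : 'I_M.+1 => (1 < n)%N && (pdiv n == Q))) /=.
  congr (_ + _); apply: eq_bigl => n; rewrite ?andbA //.
  by case: (posnP n) => // n0; rewrite roughS.
case: ifP => pQ; last first.
  rewrite mul1r {1}E big_pred0 ?add0r // => n; apply/negP => /and4P[n0 _ n1 /eqP nQ].
  by move: pQ; rewrite -nQ pdiv_prime.
rewrite mulrBl mul1r lerBlDr {1}E addrC lerD2l.
apply: le_trans (sum_pdiv_le M pQ); rewrite [leLHS]big_mkcond [leRHS]big_mkcond.
apply: ler_sum => n _; case: ifP => [/and4P[_ _ -> ->]|_] //.
by case: ifP => // _; rewrite invr_ge0.
Qed.

(** [rough_sum M 0] is the harmonic sum, while [rough_sum M M.+1] retains at most the integer 1.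
    Iterating [rough_sumS] bounds the harmonic sum times the product of the [1 - 1/p] by 1. *)
Lemma harmonic_le_prime_sum M :
  series (@harmonic R) M <=
  expR (2 * \sum_(0 <= p < M.+1 | prime p) (p%:R)^-1).
Proof.
have H0 : series (@harmonic R) M = rough_sum M 0.
  rewrite seriesEord /rough_sum big_mkcond big_ord_recl /= add0r.
  by apply: eq_bigr => n _; rewrite /rough leq0n orbT.
have pos Q : (0 : R) <= if prime Q then 1 - Q%:R^-1 else 1.
  case: ifP => // pQ; rewrite subr_ge0 invf_le1 ?ltr0n ?prime_gt0 //.
  by rewrite ler1n prime_gt0.
have step Q : (\prod_(0 <= p < Q) if prime p then 1 - p%:R^-1 else 1) *
    rough_sum M 0 <= rough_sum M Q.
  elim: Q => [|Q IH]; first by rewrite big_geq // mul1r.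
  rewrite big_nat_recr //= mulrAC mulrC.
  by apply: le_trans (rough_sumS M Q); apply: ler_wpM2l.
have S1 : rough_sum M M.+1 <= 1.
  rewrite /rough_sum; apply: le_trans
    (_ : _ <= \sum_(n < M.+1 | n == 1%N :> nat) (n%:R)^-1) _.
    rewrite [leLHS]big_mkcond [leRHS]big_mkcond; apply: ler_sum => n _.
    rewrite /rough; case: eqP => [->|n1] /=; first by rewrite lexx.
    case: ifP => // /andP[n0 /= h]; have := leq_ltn_trans (pdiv_leq n0) (ltn_ord n).
    by rewrite ltnNge h.
  rewrite (big_ord1_eq _ (fun n => (n%:R)^-1)); case: ifP => _; rewrite ?invr1 //.
(* Applied at [x = 1/p <= 1/2], where [(1 + 2x)(1 - x) = 1 + x(1 - 2x) >= 1]; this is the source of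
   the constant 2. *)
have e0 (x : R) : 0 <= x <= 2^-1 -> 1 <= expR (2 * x) * (1 - x).
  move=> /andP[x0 x1]; apply: le_trans (_ : 1 <= (1 + 2 * x) * (1 - x)) _.
    by nra.
  by apply: ler_wpM2r; [lra|exact: expR_ge1Dx].
have P : 1 <= expR (2 * \sum_(0 <= p < M.+1 | prime p) (p%:R)^-1) *
    \prod_(0 <= p < M.+1) (if prime p then 1 - p%:R^-1 else 1 : R).
  rewrite mulr_sumr expR_sum -big_mkcond -big_split /=.
  elim/big_rec: _ => [|p x pp x1]; first exact: lexx.
  rewrite -[leLHS]mulr1 ler_pM //; apply: e0.
  by rewrite invr_ge0 ler0n lef_pV2 ?posrE ?ltr0n ?prime_gt0 // ler_nat prime_gt1.
rewrite H0 -[leLHS]mul1r.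
have r0 : 0 <= rough_sum M 0 by rewrite sumr_ge0 // => n _; rewrite invr_ge0.
apply: le_trans (ler_wpM2r r0 P) _; rewrite -mulrA ler_piMr ?expR_ge0 //.
exact: le_trans (step M.+1) S1.
Qed.

Lemma prime_reciprocals_unbounded (C : R) :
  exists M, C < \sum_(0 <= p < M.+1 | prime p) (p%:R)^-1.
Proof.
apply/not_existsP => h; apply: (@dvg_harmonic R); apply: nondecreasing_is_cvgn.
  by apply/nondecreasing_series => n _ _; apply: ltW; apply: harmonic_gt0.
exists (expR (2 * C)) => _ [M _ <-]; apply: le_trans (harmonic_le_prime_sum M) _.
by rewrite ler_expR ler_pM2l // leNgt; apply/negP; exact: h.
Qed.

End PrimeReciprocals.

(** * Necessity of the condition for absolute convergence *)

Section Necessity.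
Variables (R : realType) (r k : nat) (s : 'I_r -> R[i]).
Hypothesis k_gt0 : (0 < k)%N.
Variable I : {set 'I_r}.
Hypothesis kI : (k <= #|I|)%N.

Definition prime_tuple (p : nat) : {ffun 'I_r -> nat} :=
  [ffun i => if i \in I then p else 1%N].

Lemma prime_tuple_inj : injective prime_tuple.
Proof.
move=> p q /ffunP e; have /card_gt0P[i iI] := leq_trans k_gt0 kI.
by have := e i; rewrite !ffunE iI.
Qed.

(** Only the prime [p] contributes, with coefficient ['C(#|I|.-1, k.-1)] up to sign, a nonzero
    integer because [k <= #|I|]. *)
Lemma norm_psi_prime_tuple p : prime p -> 1 <= `|psi k (prime_tuple p)|.
Proof.
move=> pp; rewrite /psi.
have -> : (\prod_(i < r) prime_tuple p i = p ^ #|I|)%N.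
  by rewrite -prod_nat_const [RHS]big_mkcond; apply: eq_bigr => i _; rewrite ffunE.
rewrite primesX ?(leq_trans k_gt0) // primes_prime // big_seq1.
rewrite -/(local_coef _ _).
have -> : local_coef k (fun i => logn p (prime_tuple p i)) =
    local_coef k (fun i => i \in I).
  congr (local_coef k _); apply/funext => i.
  by rewrite ffunE; case: (i \in I); rewrite ?logn1 // -[X in logn _ X]expn1 pfactorK.
rewrite local_coef_indicator /sieve_coef kI mul1r.
have /negPf -> : #|I| != 0%N by rewrite -lt0n (leq_trans k_gt0).
rewrite sub0r normrN normrM normrX normrN1 expr1n mul1r normr_nat.
by rewrite ler1n bin_gt0 -!subn1 leq_sub2r.
Qed.

Lemma cabs_D_term_prime_tuple p : prime p ->
  complex.Re (\sum_(i in I) s i) <= 1 ->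
  (p%:R)^-1 <= cabs (D_term k s (prime_tuple p)).
Proof.
move=> pp sI; have p0 := prime_gt0 pp.
rewrite /D_term cabsM cabs_int cabs_prod.
have -> : \prod_(i < r) cabs (natcpow (prime_tuple p i) (- s i)) =
    p%:R `^ (- complex.Re (\sum_(i in I) s i)).
  rewrite -prod_powR // [RHS]big_mkcond; apply: eq_bigr => i _.
  rewrite ffunE; case: ifP => _; last by rewrite natcpow1 cabs1.
  by rewrite cabs_natcpow //; case: (s i).
apply: le_trans (_ : _ <= p%:R `^ (- complex.Re (\sum_(i in I) s i))) _.
  by rewrite -powR_inv1 // ler_powR ?ler1n // lerN2.
by rewrite ler_peMl ?powR_ge0 // -[1]/(1%:~R) ler_int norm_psi_prime_tuple.
Qed.

(** Otherwise each [prime_tuple p] contributes at least [1/p]. These tuples are distinct, so the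
    finite total [E] would bound every partial sum of the reciprocals of the primes. *)
Lemma abs_convergent_Re_gt1 :
  abs_convergent (@positive_tuples r) (D_term k s) ->
  1 < complex.Re (\sum_(i in I) s i).
Proof.
rewrite /abs_convergent; set E := esum _ _ => Efin.
rewrite ltNge; apply/negP => sI.
have [M] := prime_reciprocals_unbounded (fine E); apply/negP; rewrite -leNgt.
have E0 : (0 <= E)%E by apply: esum_ge0 => n _; rewrite lee_fin cabs_ge0.
rewrite -lee_fin fineK ?ge0_fin_numE //.
rewrite -big_filter; set q := [seq p <- _ | prime p].
have qU : uniq q by rewrite filter_uniq ?iota_uniq.
have q_prime p : p \in q -> prime p by rewrite mem_filter => /andP[].
move: q qU q_prime => q qU q_prime.
pose A := [fset prime_tuple p | p in q]%fset.
apply: esum_ge; exists [set` A].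
  split=> // n /= /imfsetP[p /= /q_prime pp] -> i.
  by rewrite ffunE; case: ifP => // _; apply: prime_gt0.
rewrite fsbig_finite // set_fsetK sumEFin lee_fin.
rewrite big_imfset; last by move=> p p' _ _; apply: prime_tuple_inj.
rewrite [enum_finmem _]/= undup_id // [leLHS]big_seq [leRHS]big_seq.
by apply: ler_sum => p /q_prime pp; apply: cabs_D_term_prime_tuple.
Qed.

End Necessity.

Theorem theorem2p1 (R : realType) (r k : nat) (hk : (2 <= k)%N)
    (hkr : (k <= r)%N) :
  (forall s : 'I_r -> R[i],
     (forall i, 1 < complex.Re (s i)) ->
     cvgn (D_partial k s) /\
     has_sum (@positive_tuples r)
       (fun n => (rho k n)%:R / \prod_(i < r) natcpow (n i) (s i))
       ((\prod_(i < r) zeta (s i)) * D_prod k s)) /\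
  (forall s : 'I_r -> R[i],
     abs_convergent (@positive_tuples r) (D_term k s) <->
     (forall I : {set 'I_r}, (k <= #|I| <= r)%N ->
        1 < complex.Re (\sum_(i in I) s i))).
Proof.
have k0 : (0 < k)%N := ltnW hk.
split=> [s s1|s]; first exact: kwise_coprime_series.
split=> [h I /andP[kI _]|h]; first exact: abs_convergent_Re_gt1 h.
apply: D_term_abs_convergent => // I kI; apply: h.
by rewrite kI -[X in (_ <= X)%N]card_ord max_card.
Qed.
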